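(* Let $X$ be a compact Hausdorff space which does not contain a closed subset homeomorphic to the Stone–Čech compactification $\beta\mathbb N$ of the natural numbers. Then the Hilbert $C(X)$-module $l_2(C(X))$ is $C^*$-reflexive.
   Context: For a $C^*$-algebra $A$, $l_2(A)$ is the right Hilbert $A$-module of sequences $(a_i)$ in $A$ with $\sum_i a_i^*a_i$ norm convergent, inner product $\langle a,b\rangle=\sum_i a_i^*b_i$. For a Hilbert $A$-module $M$, the dual $M'$ is the Banach $A$-module of bounded $A$-module maps $M\to A$, and the second dual $M''$ is the module of bounded $A$-module maps $M'\to A$ (with Paschke's standard conventions); there are canonical isometric inclusions $M\subseteq M''\subseteq M'$. $M$ is called $C^*$-reflexive if $M''=M$, i.e. the canonical map $M\to M''$ is surjective. *)

(* Defs.v *)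
From HB Require Import structures.
From mathcomp Require Import all_boot all_order all_algebra.
From mathcomp Require Import all_classical all_reals all_analysis.
From mathcomp Require Import complex.
Import Order.TTheory GRing.Theory Num.Theory.
Import numFieldTopology.Exports numFieldNormedType.Exports.

Set Implicit Arguments.
Unset Strict Implicit.
Unset Printing Implicit Defensive.

Local Open Scope ring_scope.
Local Open Scope classical_set_scope.

(* The Stone-Cech compactification beta N of the natural numbers,      *)
(* realised (as usual) as the space of ultrafilters on nat with the    *)
(* Stone topology, whose basic open sets are {p | A \in p}, A : set nat *)

Record betaN := BetaN { bn_filter : set_system nat ;
                        bn_ultra : UltraFilter bn_filter }.

HB.instance Definition _ := gen_eqMixin betaN.
HB.instance Definition _ := gen_choiceMixin betaN.

Definition betaN_base (A : set nat) : set betaN := [set p | bn_filter p A].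

Lemma betaN_base_cover : \bigcup_(A in [set: set nat]) betaN_base A = setT.
Proof.
apply/seteqP; split => // p _; exists setT => //.
rewrite /betaN_base /=; have := bn_ultra p => U; exact: filterT.
Qed.

Lemma betaN_base_join (A B : set nat) (p : betaN) :
  [set: set nat] A -> [set: set nat] B -> betaN_base A p -> betaN_base B p ->
  exists K, [/\ [set: set nat] K, betaN_base K p &
                betaN_base K `<=` betaN_base A `&` betaN_base B].
Proof.
move=> _ _ pA pB; exists (A `&` B); split => //.
  by rewrite /betaN_base /=; have := bn_ultra p => U; exact: filterI.
move=> q; rewrite /betaN_base /= => qAB; have := bn_ultra q => U; split.
  by apply: filterS qAB => x [].
by apply: filterS qAB => x [].
Qed.

HB.instance Definition _ :=
  isBaseTopological.Build betaN betaN_base_cover betaN_base_join.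

Definition homeomorphic_to_subset (Y X : topologicalType) (F : set X) :=
  exists f : Y -> X,
    [/\ f @` setT = F, injective f, continuous f &
        forall U : set Y, open U -> exists V : set X, open V /\ f @` U = V `&` F].

(* the complex numbers over the real field R, with their norm topology *)
Definition Cplx (R : realType) := (R[i])^o.

Section Hilbert.
Variables (R : realType) (X : topologicalType).
Local Notation C := (Cplx R).

Definition CX : set (X -> C) := [set f | continuous f].

Definition seqX := nat -> X -> C.

(* l_2(C(X)) : sequences (a_i) in C(X) such that sum_i a_i^* a_i is norm
   convergent in C(X), i.e. its partial sums converge uniformly on X to some
   element g of C(X). *)
Definition l2 : set seqX :=
  [set a : seqX | (forall i, CX (a i)) /\
     exists g : X -> C, CX g /\
       forall e : C, 0 < e -> exists N : nat, forall n : nat, (N <= n)%N ->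
         forall x : X, `| \sum_(i < n) ((a i x)^* * a i x) - g x | <= e].

(* the C(X)-valued inner product <a, b> = sum_i a_i^* b_i (pointwise value of
   the norm-convergent series) *)
Definition ip (a b : seqX) : X -> C :=
  fun x => limn (fun n => \sum_(i < n) ((a i x)^* * b i x)).

Definition seq_add (a b : seqX) : seqX := fun i x => a i x + b i x.
Definition seq_act (a : seqX) (c : X -> C) : seqX := fun i x => a i x * c x.

Definition l2_normle (a : seqX) (M : C) :=
  0 <= M /\ forall x : X, `| ip a a x | <= M ^+ 2.

Definition dual_normle (t : seqX -> X -> C) (K : C) :=
  0 <= K /\ forall (a : seqX) (M : C), l2 a -> l2_normle a M ->
                forall x : X, `| t a x | <= K * M.

Definition dual (t : seqX -> X -> C) :=
  [/\ forall a, l2 a -> CX (t a),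
      forall a b, l2 a -> l2 b -> t (seq_add a b) = (fun x => t a x + t b x),
      forall a c, l2 a -> CX c -> t (seq_act a c) = (fun x => t a x * c x) &
      exists K : C, dual_normle t K].

(* Paschke's module operations on M' : (t + s)(a) = t a + s a,
   (t . c)(a) = c^* t(a) *)
Definition dual_add (t s : seqX -> X -> C) : seqX -> X -> C :=
  fun a x => t a x + s a x.
Definition dual_act (t : seqX -> X -> C) (c : X -> C) : seqX -> X -> C :=
  fun a x => (c x)^* * t a x.

Definition bidual (F : (seqX -> X -> C) -> X -> C) :=
  [/\ forall t, dual t -> CX (F t),
      forall t s, dual t -> dual s -> F (dual_add t s) = (fun x => F t x + F s x),
      forall t c, dual t -> CX c -> F (dual_act t c) = (fun x => F t x * c x) &
      exists L : C, 0 <= L /\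
        forall (t : seqX -> X -> C) (K : C), dual t -> dual_normle t K ->
          forall x : X, `| F t x | <= L * K].

Definition canon (a : seqX) : (seqX -> X -> C) -> X -> C :=
  fun t x => (t a x)^*.

Definition l2_Cstar_reflexive :=
  forall F, bidual F -> exists a : seqX, l2 a /\
     forall t, dual t -> F t = canon a t.

End Hilbert.

(* Main.v *)
Require Import Defs.
From HB Require Import structures.
From mathcomp Require Import all_boot all_order all_algebra.
From mathcomp Require Import all_classical all_reals all_analysis.
From mathcomp Require Import complex.
From mathcomp Require Import lra.
Import Order.TTheory GRing.Theory Num.Theory.
Import numFieldTopology.Exports numFieldNormedType.Exports.
Local Open Scope ring_scope.
Local Open Scope classical_set_scope.

Set Implicit Arguments.
Unset Strict Implicit.
Unset Printing Implicit Defensive.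

(* The dual of l_2(C(X)) is the set of sequences tau in C(X) for which the
   partial sums of sum_i |tau_i|^2 are uniformly bounded.  A bidual element F has
   coordinates phi_i = F(e_i), again such a sequence, and F commutes with
   multiplication by bump functions.  For tau in the dual, every nonempty open
   set contains a point near which the tails of sum_i |tau_i|^2 are uniformly
   small, so on a dense set F(tau) is given by sum_i phi_i tau_i^*; hence F is
   determined by phi, and F is the image of phi^* provided phi^* lies in l_2.

   If sum_i |phi_i|^2 does not converge uniformly, there are disjoint blocks of
   indices I_j, points x_j with pairwise disjoint neighbourhoods U_j, and d > 0
   with sum_(i in I_j) |phi_i(x_j)|^2 > d.  With bump functions c_j supported in
   U_j and c_j(x_j) = 1, let tau_S be c_j phi_i for i in I_j, j in S, and 0
   elsewhere.  Then F(tau_S) is a continuous function larger than d at x_j for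
   j in S and zero at x_j for j not in S.  So the closures of {x_j : j in S} and
   {x_j : j not in S} are disjoint for every S, and p |-> lim_p x_j embeds
   beta N as the closure of {x_j}. *)

(** * Complex modulus and square-summable sequences *)

Section ComplexModulus.
Variable R : realType.
Local Notation C := (Cplx R).
Implicit Types (z w : C) (r : R).

(* A real-valued modulus: [`|z|] lives in the partially ordered field [R[i]]. *)
Definition nc z : R := Normc.normc (z : R[i]).

Lemma normE z : `|z| = (nc z)%:C%C.
Proof. by []. Qed.

Lemma nc_ge0 z : 0 <= nc z.
Proof. by rewrite -lecR; exact: (@normr_ge0 _ C). Qed.

Lemma nc0 : nc 0 = 0.
Proof. exact: Normc.normc0. Qed.

Lemma ncM z w : nc (z * w) = nc z * nc w.
Proof. exact: Normc.normcM. Qed.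

Lemma nc_conj z : nc (z^*) = nc z.
Proof. by apply: (@complexI R); exact: (@norm_conjC _ (z : R[i])). Qed.

Lemma ncN z : nc (- z) = nc z.
Proof. by apply: (@complexI R); rewrite -!normE normrN. Qed.

Lemma ncB z w : nc (z - w) = nc (w - z).
Proof. by rewrite -ncN opprB. Qed.

Lemma ncD z w : nc (z + w) <= nc z + nc w.
Proof. by rewrite -lecR rmorphD -!normE; exact: ler_normD. Qed.

Lemma nc_le0 z : nc z <= 0 -> z = 0.
Proof.
move=> h; apply/eqP; rewrite -normr_eq0 normE; apply/eqP.
by congr (_%:C)%C; apply/eqP; rewrite eq_le h nc_ge0.
Qed.

Lemma nc_real r : nc (r%:C)%C = `|r|.
Proof. by rewrite /nc /= expr0n addr0 sqrtr_sqr. Qed.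

Lemma mulcJ z : z * z^* = (nc z ^+ 2)%:C%C.
Proof. by rewrite rmorphXn /= -normE; exact/esym/normCK. Qed.

Lemma realC_conj r : (r%:C%C : C)^* = r%:C%C.
Proof. by apply: conj_Creal; apply/complex_realP; exists r. Qed.

Lemma nc_sum (I : Type) (s : seq I) (P : pred I) (F : I -> C) :
  nc (\sum_(i <- s | P i) F i) <= \sum_(i <- s | P i) nc (F i).
Proof.
elim/big_rec2: _ => [|i y z _ h]; first by rewrite nc0.
by apply: le_trans (ncD _ _) _; rewrite lerD2l.
Qed.

Lemma cauchy_schwarz (I : Type) (s : seq I) (P : pred I) (f g : I -> R) :
  (\sum_(i <- s | P i) f i * g i) ^+ 2 <=
  (\sum_(i <- s | P i) f i ^+ 2) * (\sum_(i <- s | P i) g i ^+ 2).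
Proof.
have ge0 (h : I -> R) t : 0 <= \sum_(i <- t | P i) h i ^+ 2.
  by apply: sumr_ge0 => i _; exact: sqr_ge0.
elim: s => [|i s IH]; first by rewrite !big_nil expr0n mul0r.
rewrite !big_cons; case: (P i) => //.
move: IH (ge0 f s) (ge0 g s).
set S := \sum_(_ <- _ | _) _; set p := \sum_(_ <- _ | _) _.
set q := \sum_(_ <- _ | _) _; move: (f i) (g i) => x y h p0 q0.
(* The squares compare: [S ^+ 2 <= p * q] by induction, and [4 * u * v <= (u + v) ^+ 2] with
   [u = p * y ^+ 2], [v = q * x ^+ 2]. *)
have cross : 2 * S * (x * y) <= p * y ^+ 2 + q * x ^+ 2.
  apply: le_trans (ler_norm _) _; rewrite -ler_sqr ?nnegrE ?normr_ge0 //; last first.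
    by rewrite addr_ge0 // mulr_ge0 // sqr_ge0.
  rewrite real_normK ?num_real //.
  have : S ^+ 2 * (x * y) ^+ 2 <= p * q * (x * y) ^+ 2.
    by rewrite ler_wpM2r // sqr_ge0.
  have := sqr_ge0 (p * y ^+ 2 - q * x ^+ 2); nra.
nra.
Qed.

Lemma cauchy_schwarz_nc (I : Type) (s : seq I) (P : pred I) (f g : I -> C) A B :
  0 <= A -> 0 <= B ->
  \sum_(i <- s | P i) nc (f i) ^+ 2 <= A ^+ 2 ->
  \sum_(i <- s | P i) nc (g i) ^+ 2 <= B ^+ 2 ->
  nc (\sum_(i <- s | P i) f i * g i) <= A * B.
Proof.
move=> A0 B0 hf hg; apply: le_trans (nc_sum _ _ _) _.
under eq_bigr do rewrite ncM.
rewrite -ler_sqr ?nnegrE; last 2 first.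
- by apply: sumr_ge0 => i _; rewrite mulr_ge0 ?nc_ge0.
- exact: mulr_ge0.
apply: le_trans (cauchy_schwarz _ _ _ _) _; rewrite exprMn.
by apply: ler_pM => //; apply: sumr_ge0 => i _; rewrite sqr_ge0.
Qed.

(** Cancels [Num.sqrt s]. The hypothesis arises when a functional of norm at most [K] is tested on a
    sequence built from its own coordinates, of square sum [s]. *)
Lemma le_sqr_sqrt (s K : R) : 0 <= s -> 0 <= K -> s <= K * Num.sqrt s -> s <= K ^+ 2.
Proof.
move=> s0 K0; have r0 := sqrtr_ge0 s; rewrite -(sqr_sqrtr s0) sqrtr_sqr ger0_norm //.
rewrite ler_sqr ?nnegrE // expr2.
have [->|rn] := eqVneq (Num.sqrt s) 0; first by [].
by rewrite ler_pM2r // lt_neqAle eq_sym rn.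
Qed.

(** In the partial order of [R[i]] a positive element is real, so the complex-valued tolerances and
    norm bounds of the definitions reduce to real ones. *)
Lemma gt0_realC (e : C) : 0 < e -> exists2 r : R, 0 < r & e = r%:C%C.
Proof.
move=> e0; have /complex_realP[r er] : (e : R[i]) \is Num.real by exact: gtr0_real.
by exists r => //; rewrite -ltcR -er.
Qed.

Lemma ge0_realC (e : C) : 0 <= e -> exists2 r : R, 0 <= r & e = r%:C%C.
Proof.
move=> e0; have /complex_realP[r er] : (e : R[i]) \is Num.real by exact: ger0_real.
by exists r => //; rewrite -lecR -er.
Qed.

Lemma cvgCP (u : nat -> C) z :
  u @ \oo --> z <->
  forall e, 0 < e -> exists N, forall n, (N <= n)%N -> nc (u n - z) <= e.
Proof.
split=> [/cvgrPdist_le h e e0|h].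
  have [|N _ HN] := h e%:C%C; first by rewrite ltcR.
  by exists N => n /HN /=; rewrite ncB normE lecR.
apply/cvgrPdist_le => _ /gt0_realC[e e0 ->]; have [N HN] := h _ e0.
by exists N => // n /HN /=; rewrite ncB normE lecR.
Qed.

Lemma nc_Re z : `|complex.Re z| <= nc z.
Proof. by rewrite -lecR -normE; exact: normc_ge_Re. Qed.

Lemma nc_Im z : `|complex.Im z| <= nc z.
Proof.
case: z => a b /=; rewrite /nc /= -sqrtr_sqr ler_sqrt ?addr_ge0 ?sqr_ge0 //.
by rewrite lerDr sqr_ge0.
Qed.

Lemma nc_le_ReIm z : nc z <= `|complex.Re z| + `|complex.Im z|.
Proof.
rewrite {1}[z : R[i]](complexE (z : R[i])).
apply: le_trans (ncD _ _) _; rewrite -!nc_real lerD2l ncM.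
by rewrite {1}/nc /= expr0n add0r expr1n sqrtr1 mul1r.
Qed.

Lemma real_cauchy_cvg (u : nat -> R) :
  (forall e, 0 < e -> exists N, forall m n, (N <= m)%N -> (N <= n)%N ->
     `|u m - u n| <= e) ->
  exists l, forall e, 0 < e -> exists N, forall n, (N <= n)%N -> `|u n - l| <= e.
Proof.
move=> h; have /cvg_ex[l /cvgrPdist_le ul] : cvgn u.
  apply/cauchy_cvgP/cauchy_exP => e e0; have [N HN] := h _ (divr_gt0 e0 (ltr0Sn R 1)).
  exists (u N), N => // n /= Nn; apply: le_lt_trans (HN _ _ (leqnn N) Nn) _.
  by rewrite ltr_pdivrMr // ltr_pMr // ltr1n.
exists l => e /ul[N _ HN]; exists N => n /HN /=; by rewrite distrC.
Qed.

Lemma cauchyC_cvg (u : nat -> C) :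
  (forall e, 0 < e -> exists N, forall m n, (N <= m <= n)%N ->
     nc (u n - u m) <= e) -> exists z, u @ \oo --> z.
Proof.
move=> h.
have h' e : 0 < e -> exists N, forall m n, (N <= m)%N -> (N <= n)%N -> nc (u m - u n) <= e.
  move=> /h[N HN]; exists N => m n Nm Nn.
  by have [mn|/ltnW nm] := leqP m n; [rewrite ncB|]; apply: HN; rewrite ?Nm ?Nn.
have [|a ha] := @real_cauchy_cvg (fun n => complex.Re (u n)).
  move=> e /h'[N HN]; exists N => m n Nm Nn.
  by apply: le_trans (HN _ _ Nm Nn); rewrite -raddfB; exact: nc_Re.
have [|b hb] := @real_cauchy_cvg (fun n => complex.Im (u n)).
  move=> e /h'[N HN]; exists N => m n Nm Nn.
  by apply: le_trans (HN _ _ Nm Nn); rewrite -raddfB; exact: nc_Im.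
exists (a +i* b)%C; apply/cvgCP => e e0.
have e2 : 0 < e / 2 by rewrite divr_gt0.
have [N1 H1] := ha _ e2; have [N2 H2] := hb _ e2.
exists (maxn N1 N2) => n; rewrite geq_max => /andP[/H1 h1 /H2 h2].
apply: le_trans (nc_le_ReIm _) _; rewrite !raddfB /= (splitr e).
exact: lerD.
Qed.

End ComplexModulus.

(** * Square-summable sequences and their pairing *)

Section SquareSummable.
Variable R : realType.
Local Notation C := (Cplx R).
Implicit Types (tau a : nat -> C) (K A B e : R) (m n N : nat).

Definition ss a m n : R := \sum_(m <= i < n) nc (a i) ^+ 2.

Definition l2bd K a := forall n, ss a 0 n <= K ^+ 2.

(** Bilinear, without conjugation, since a dual element acts by [sum_i tau_i a_i]. The limit is
    meaningful only if the series converges, which [pairing_cvg] ensures. *)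
Definition pairing tau a : C := limn (fun n => \sum_(i < n) tau i * a i).

Lemma ss_ge0 a m n : 0 <= ss a m n.
Proof. by apply: sumr_ge0 => i _; rewrite sqr_ge0. Qed.

Lemma ss_cat a m n p : (m <= n <= p)%N -> ss a m p = ss a m n + ss a n p.
Proof. by case/andP=> mn np; rewrite /ss (big_cat_nat mn np). Qed.

Lemma ss_le a m n m' n' : (m <= m')%N -> (n' <= n)%N -> ss a m' n' <= ss a m n.
Proof.
move=> mm nn; have [m'n'|n'm'] := leqP m' n'; last first.
  by rewrite {1}/ss big_geq ?ss_ge0 // ltnW.
rewrite (@ss_cat a m m' n) ?mm ?(leq_trans m'n') // (@ss_cat a m' n' n) ?m'n' //.
by have := ss_ge0 a m m'; have := ss_ge0 a n' n; lra.
Qed.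

Lemma ss_le_l2bd K a m n : l2bd K a -> ss a m n <= K ^+ 2.
Proof. by move=> /(_ n); apply: le_trans; exact: ss_le. Qed.

(** With [s = ss a 0 N >= 0], the bound is [s + 1 <= (s + 1) ^+ 2], which avoids a square root. *)
Lemma l2bd_tail a N : (forall n, ss a N n <= 1) -> l2bd (ss a 0 N + 1) a.
Proof.
move=> h n; apply: (@le_trans _ _ (ss a 0 N + ss a N n)).
  have [Nn|/ltnW nN] := leqP N n; first by rewrite (@ss_cat a 0 N) ?Nn.
  by have := @ss_le a 0 N 0 n (leqnn 0) nN; have := ss_ge0 a N n; lra.
by have := h n; have := ss_ge0 a 0 N; nra.
Qed.

Lemma ss_nc a n : \sum_(i < n) nc (a i) ^+ 2 = ss a 0 n.
Proof. by rewrite /ss big_mkord. Qed.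

Lemma ss_conj a m n : ss (fun i => (a i)^*) m n = ss a m n.
Proof. by apply: eq_bigr => i _; rewrite nc_conj. Qed.

Lemma sum_conj_mul a n : \sum_(i < n) (a i)^* * a i = (ss a 0 n)%:C%C.
Proof.
rewrite -ss_nc rmorph_sum /=; apply: eq_bigr => i _.
by rewrite mulrC; exact: mulcJ.
Qed.

Lemma ss_tail K a : l2bd K a -> forall e, 0 < e -> exists N, forall n, ss a N n <= e.
Proof.
move=> aK e e0; pose E := range (ss a 0).
have supE : has_sup E.
  by split; [exists (ss a 0 0), 0%N | exists (K ^+ 2) => _ [n _ <-]; exact: aK].
have [_ [N _ <-] HN] := sup_adherent e0 supE.
exists N => n; have [Nn|/ltnW nN] := leqP N n; last first.
  by rewrite /ss big_geq ?ltW.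
have : ss a 0 n <= sup E by apply: ub_le_sup; [case: supE | exists n].
rewrite (@ss_cat a 0 N n) ?Nn //; lra.
Qed.

Lemma sum_tail tau a m n : (m <= n)%N ->
  \sum_(i < n) tau i * a i - \sum_(i < m) tau i * a i =
  \sum_(m <= i < n) tau i * a i.
Proof.
move=> mn; rewrite -!(big_mkord xpredT (fun i => tau i * a i)).
by rewrite (big_cat_nat (leq0n m) mn) /= addrAC subrr add0r.
Qed.

Lemma pairing_lim tau a z :
  (fun n => \sum_(i < n) tau i * a i) @ \oo --> z -> pairing tau a = z.
Proof. by move=> h; apply: cvg_lim h; exact: norm_hausdorff. Qed.

Lemma pairing_cvg K L tau a : l2bd K tau -> l2bd L a ->
  (fun n => \sum_(i < n) tau i * a i) @ \oo --> pairing tau a.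
Proof.
move=> tK aL.
have [e e0|z hz] := @cauchyC_cvg R (fun n => \sum_(i < n) tau i * a i : C).
  (* The sign of [K] is unknown, and a positive divisor is wanted. *)
  have K1 : 0 < `|K| + 1 by rewrite ltr_wpDl.
  have [|N HN] := ss_tail aL (e := (e / (`|K| + 1)) ^+ 2).
    by rewrite exprn_gt0 // divr_gt0.
  exists N => m n /andP[Nm mn]; rewrite sum_tail //.
  have -> : e = (`|K| + 1) * (e / (`|K| + 1)) by rewrite mulrC divfK // gt_eqF.
  apply: cauchy_schwarz_nc; [exact: ltW | by rewrite ltW ?divr_gt0 | |].
    apply: le_trans (ss_le_l2bd m n tK) _; rewrite -real_normK ?num_real //.
    by rewrite ler_sqr ?nnegrE ?(ltW K1) // lerDl.
  by apply: le_trans (HN n); exact: ss_le.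
by rewrite (pairing_lim hz).
Qed.

Lemma cvgC_bound (u : nat -> C) z w B N : u @ \oo --> z ->
  (forall n, (N <= n)%N -> nc (u n - w) <= B) -> nc (z - w) <= B.
Proof.
move=> /cvgCP uz h; apply/ler_addgt0Pr => e e0.
have [M HM] := uz _ e0.
have := h _ (leq_maxl N M); have := HM _ (leq_maxr N M).
set v := u _ => h1 h2; have := ncD (z - v) (v - w).
rewrite addrA subrK (ncB z v) => h3; move: h1 h2 h3; lra.
Qed.

(** Cauchy-Schwarz on the blocks from [N] to [n], then [n] tends to infinity. One small tail
    suffices if the other is bounded; all later approximations rest on this. *)
Lemma pairing_tail K L tau a A B N : l2bd K tau -> l2bd L a ->
  0 <= A -> 0 <= B ->
  (forall n, ss tau N n <= A ^+ 2) -> (forall n, ss a N n <= B ^+ 2) ->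
  nc (pairing tau a - \sum_(i < N) tau i * a i) <= A * B.
Proof.
move=> tK aL A0 B0 hA hB; apply: (cvgC_bound (N := N) (pairing_cvg tK aL)) => n Nn.
by rewrite sum_tail //; apply: cauchy_schwarz_nc => //; [exact: hA | exact: hB].
Qed.

Lemma pairing_le K L tau a : 0 <= K -> 0 <= L -> l2bd K tau -> l2bd L a ->
  nc (pairing tau a) <= K * L.
Proof.
move=> K0 L0 tK aL; have := @pairing_tail K L tau a K L 0 tK aL K0 L0 tK aL.
by rewrite big_ord0 subr0.
Qed.

Lemma pairing_fin tau a n : (forall i, (n <= i)%N -> tau i * a i = 0) ->
  pairing tau a = \sum_(i < n) tau i * a i.
Proof.
move=> h; apply: pairing_lim; apply/cvgCP => e e0; exists n => m nm.
by rewrite sum_tail // big_nat big1 ?nc0 ?ltW // => i /andP[/h].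
Qed.

(** From [|u + v|^2 <= 2 |u|^2 + 2 |v|^2]; the constant is not sharp, as only boundedness
    matters. *)
Lemma l2bdD K L tau a : 0 <= K -> 0 <= L -> l2bd K tau -> l2bd L a ->
  l2bd (2 * (K + L)) (fun i => tau i + a i).
Proof.
move=> K0 L0 tK aL n.
apply: (@le_trans _ _ (2 * ss tau 0 n + 2 * ss a 0 n)).
  rewrite /ss !mulr_sumr -big_split /=; apply: ler_sum => i _.
  have := ncD (tau i) (a i); have := nc_ge0 (tau i + a i).
  by have := sqr_ge0 (nc (tau i) - nc (a i)); nra.
by have := tK n; have := aL n; nra.
Qed.

Lemma l2bdZ K a c A : 0 <= K -> nc c <= A -> l2bd K a -> l2bd (K * A) (fun i => a i * c).
Proof.
move=> K0 cA aK n; rewrite /ss.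
under eq_bigr do rewrite ncM exprMn.
rewrite -mulr_suml exprMn; apply: ler_pM; rewrite ?sqr_ge0 ?ss_ge0 //; first exact: aK.
by rewrite ler_sqr ?nnegrE ?nc_ge0 // (le_trans (nc_ge0 _) cA).
Qed.

End SquareSummable.

(** * The module l_2(C(X)) and its dual *)

Section ContinuousFunctions.
Variables (R : realType) (X : topologicalType).
Local Notation C := (Cplx R).
Implicit Types f g : X -> C.

Lemma CXP f : CX f <->
  forall x e, 0 < e -> \forall y \near x, nc (f x - f y) <= e.
Proof.
split=> [cf x e e0|h x].
  have /cvgrPdist_le /(_ e%:C%C) := cf x; rewrite ltcR => /(_ e0).
  by apply: filterS => y; rewrite normE lecR.
apply/cvgrPdist_le => _ /gt0_realC[e e0 ->].
by apply: filterS (h x e e0) => y; rewrite normE lecR.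
Qed.

Lemma CX_cst (c : C) : CX (fun _ : X => c).
Proof. by move=> x; exact: cvg_cst. Qed.

Lemma CXD f g : CX f -> CX g -> CX (fun x => f x + g x).
Proof. by move=> cf cg x; apply: cvgD; [exact: cf | exact: cg]. Qed.

Lemma CXM f g : CX f -> CX g -> CX (fun x => f x * g x).
Proof. by move=> cf cg x; apply: cvgM; [exact: cf | exact: cg]. Qed.

Lemma CX_conj f : CX f -> CX (fun x => (f x)^*).
Proof.
move=> /CXP cf; apply/CXP => x e /(cf x); apply: filterS => y.
by rewrite -rmorphB; rewrite nc_conj.
Qed.

Lemma CX_sum n (F : nat -> X -> C) : (forall i, CX (F i)) ->
  CX (fun x => \sum_(i < n) F i x).
Proof.
move=> cF; elim: n => [|n IH].
  by under eq_fun do rewrite big_ord0; exact: CX_cst.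
under eq_fun do rewrite big_ord_recr /=.
apply: CXD; [exact: IH | exact: cF].
Qed.

Lemma CX_ulim f : (forall e, 0 < e -> exists2 g, CX g & forall x, nc (f x - g x) <= e) ->
  CX f.
Proof.
move=> h; apply/CXP => x e e0.
have [|g /CXP cg fg] := h (e / 3); first by rewrite divr_gt0.
have := cg x (e / 3); rewrite divr_gt0 // => /(_ isT); apply: filterS => y gxy.
have -> : f x - f y = (f x - g x) + (g x - g y) + (g y - f y).
  by rewrite !addrA !subrK.
apply: le_trans (ncD _ _) _; have := ncD (f x - g x) (g x - g y).
by have := fg x; have := fg y; rewrite (ncB (f y)); move: gxy; lra.
Qed.

Lemma CX_real (r : X -> R) : continuous r -> CX (fun x => (r x)%:C%C : C).
Proof.
move=> cr; apply/CXP => x e e0; have /cvgrPdist_le /(_ e e0) := cr x.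
by apply: filterS => y; rewrite -nc_real rmorphB.
Qed.

Lemma CX_lt f (r : R) x : CX f -> r < nc (f x) -> \forall y \near x, r < nc (f y).
Proof.
move=> /CXP cf h; have := cf x ((nc (f x) - r) / 2).
rewrite divr_gt0 ?subr_gt0 // => /(_ isT); apply: filterS => y.
by have := ncD (f x - f y) (f y); rewrite subrK; lra.
Qed.

Lemma CX_ss (a : seqX R X) m n (r : R) x : (forall i, CX (a i)) ->
  r < ss (a^~ x) m n -> \forall y \near x, r < ss (a^~ y) m n.
Proof.
move=> ca; pose f y : C := (\sum_(m <= i < n) a i y * (a i y)^*).
have fE y : f y = (ss (a^~ y) m n)%:C%C.
  by rewrite rmorph_sum; apply: eq_bigr => i _; exact: mulcJ.
have ncf y : nc (f y) = ss (a^~ y) m n by rewrite fE nc_real ger0_norm ?ss_ge0.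
have cf : CX f.
  rewrite /f; elim: (index_iota m n) => [|i s IH].
    by under eq_fun do rewrite big_nil; exact: CX_cst.
  under eq_fun do rewrite big_cons; apply: CXD; last exact: IH.
  by apply: CXM; [exact: ca | apply: CX_conj; exact: ca].
by rewrite -ncf => /(CX_lt cf); apply: filterS => y; rewrite ncf.
Qed.

End ContinuousFunctions.

(** * Uniformly small tails and the norm of l_2(C(X)) *)

Section L2.
Variables (R : realType) (X : topologicalType).
Local Notation C := (Cplx R).
Local Notation seqX := (seqX R X).
Implicit Types (a b : seqX) (K M e : R) (m n N : nat).

Lemma ipE a x : ip a a x = pairing (fun i => (a i x)^*) (a^~ x).
Proof. by []. Qed.

(** Norm convergence as a uniform Cauchy condition. One way, two partial sums are each within
    [e / 2] of the limit; conversely [ip a a] is the limit, continuous as a uniform limit of partial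
    sums. *)
Lemma l2P a : l2 a <-> (forall i, CX (a i)) /\
  forall e, 0 < e -> exists N, forall x n, ss (a^~ x) N n <= e.
Proof.
split=> -[ca].
  case=> g [_ hg]; split=> // e e0.
  have e2 : 0 < (e / 2)%:C%C :> C by rewrite ltcR divr_gt0.
  have [N HN] := hg _ e2; exists N => x n.
  have [Nn|/ltnW nN] := leqP N n; last by rewrite /ss big_geq // ltW.
  have := HN _ (leqnn N) x; have := HN _ Nn x.
  rewrite !normE !lecR !(sum_conj_mul (a^~ x)) => h1 h2.
  have := ncD ((ss (a^~ x) 0 n)%:C%C - g x) (g x - (ss (a^~ x) 0 N)%:C%C).
  rewrite addrA subrK (ncB (g x)) -rmorphB nc_real.
  rewrite (@ss_cat _ (a^~ x) 0 N n) ?Nn //.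
  have := ler_norm (ss (a^~ x) 0 N + ss (a^~ x) N n - ss (a^~ x) 0 N).
  move: h1 h2; rewrite (@ss_cat _ (a^~ x) 0 N n) ?Nn //; lra.
move=> h; split=> //.
have bd x : exists L, l2bd L (a^~ x).
  by have [N HN] := h 1 ltr01; exists (ss (a^~ x) 0 N + 1); exact: (l2bd_tail (HN x)).
have H e : 0 < e -> exists N, forall n, (N <= n)%N -> forall x,
    nc (ip a a x - \sum_(i < n) (a i x)^* * a i x) <= e.
  move=> e0; have [N HN] := h e e0; exists N => n Nn x; have [L aL] := bd x.
  have cL : l2bd L (fun i => (a i x)^*) by move=> k; rewrite ss_conj.
  have r0 := sqrtr_ge0 e; rewrite ipE.
  have -> : e = Num.sqrt e * Num.sqrt e by rewrite -expr2 sqr_sqrtr // ltW.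
  apply: (pairing_tail cL aL) => // k; rewrite ?ss_conj sqr_sqrtr ?(ltW e0) //;
    by apply: le_trans (HN x k); exact: ss_le.
exists (ip a a); split.
  apply: CX_ulim => e /H[N HN]; exists (fun x => \sum_(i < N) (a i x)^* * a i x).
    by apply: (CX_sum (F := fun i x => (a i x)^* * a i x)) => i; apply: CXM => //; exact: CX_conj.
  by move=> x; exact: HN.
move=> _ /gt0_realC[e e0 ->]; have [N HN] := H e e0; exists N => n Nn x.
by rewrite normE lecR ncB; exact: HN.
Qed.

Lemma l2_CX a i : l2 a -> CX (a i).
Proof. by case. Qed.

Lemma l2_l2bd a x : l2 a -> exists2 L, 0 <= L & l2bd L (a^~ x).
Proof.
case/l2P => _ h; have [N HN] := h 1 ltr01; exists (ss (a^~ x) 0 N + 1).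
  by rewrite addr_ge0 ?ss_ge0.
exact: (l2bd_tail (HN x)).
Qed.

(** At each point the partial sums of squares increase to [ip a a x]. *)
Lemma l2_normleP a M : l2 a -> 0 <= M ->
  l2_normle a M%:C%C <-> forall x, l2bd M (a^~ x).
Proof.
move=> l2a M0; split=> [[_ h] x n|h].
  have [L L0 aL] := l2_l2bd x l2a.
  have cL : l2bd L (fun i => (a i x)^*) by move=> k; rewrite ss_conj.
  apply/ler_addgt0Pr => e e0.
  have /cvgCP /(_ _ e0)[N HN] := pairing_cvg cL aL.
  have := HN _ (leq_maxl N n); rewrite -ipE (sum_conj_mul (a^~ x)).
  have := ss_le (a^~ x) (leqnn 0) (leq_maxr N n).
  move: (h x); rewrite normE -rmorphXn lecR.
  set s := ss _ 0 (maxn _ _) => h1 h2 h3.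
  have := ncD (s%:C%C - ip a a x) (ip a a x).
  rewrite subrK nc_real; have := ler_norm s; move: h1 h2 h3; lra.
split=> [|x]; first by rewrite lecR.
have cL : l2bd M (fun i => (a i x)^*) by move=> k; rewrite ss_conj; exact: h.
by rewrite normE -rmorphXn lecR; exact: (pairing_le M0 M0 cL (h x)).
Qed.

Lemma l2_fin a N : (forall i, CX (a i)) ->
  (forall i, (N <= i)%N -> a i = fun _ => 0) -> l2 a.
Proof.
move=> ca h; apply/l2P; split=> // e e0; exists N => x n.
by rewrite /ss big_nat big1 ?ltW // => i /andP[/h -> _]; rewrite nc0 expr0n.
Qed.

End L2.

(** * Representation of the dual by bounded sequences *)

Section Dual.
Variables (R : realType) (X : topologicalType).
Local Notation C := (Cplx R).
Local Notation seqX := (seqX R X).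
Implicit Types (a b tau : seqX) (t : seqX -> X -> C) (K M e : R) (m n N : nat).

Definition bdseq K tau := (forall i, CX (tau i)) /\ forall x, l2bd K (tau^~ x).

(* The dual module consists of the functionals [a |-> sum_i tau_i a_i], where
   [tau] is a sequence in C(X) with uniformly bounded partial sums of
   [|tau_i|^2]; [dual_functional] and [dual_bdseq] give the converse. *)
Definition functional tau : seqX -> X -> C := fun a x => pairing (tau^~ x) (a^~ x).

Definition delta i : seqX := fun j _ => (i == j)%:R.

Definition trunc n a : seqX := fun i x => if (i < n)%N then a i x else 0.

Lemma CX_delta i j : CX (delta i j).
Proof. exact: CX_cst. Qed.

Lemma l2_delta i : l2 (delta i).
Proof.
apply: (l2_fin (N := i.+1)) => [j|j ij]; first exact: CX_delta.
by rewrite /delta ltn_eqF.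
Qed.

Lemma CX_trunc n a : (forall i, CX (a i)) -> forall i, CX (trunc n a i).
Proof. by move=> ca i; rewrite /trunc; case: ltnP => // _; exact: CX_cst. Qed.

Lemma l2_trunc n a : (forall i, CX (a i)) -> l2 (trunc n a).
Proof.
move=> ca; apply: (l2_fin (N := n)) => [|i ni]; first exact: CX_trunc.
by apply/funext => x; rewrite /trunc ltnNge ni.
Qed.

Lemma trunc0 a : trunc 0 a = fun _ _ => 0.
Proof. by []. Qed.

(** Writes truncations by module operations on the unit vectors, so that inductions can use
    additivity and C(X)-linearity. *)
Lemma truncS n a : trunc n.+1 a = seq_add (trunc n a) (seq_act (delta n) (a n)).
Proof.
apply/funext => i; apply/funext => x; rewrite /trunc /seq_add /seq_act /delta ltnS.
by case: ltngtP => [||<-]; rewrite ?mul0r ?mul1r ?addr0 ?add0r.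
Qed.

Definition tail n a : seqX := fun i x => if (i < n)%N then 0 else a i x.

Lemma trunc_tail n a : a = seq_add (trunc n a) (tail n a).
Proof.
apply/funext => i; apply/funext => x; rewrite /trunc /tail /seq_add.
by case: ltnP; rewrite ?addr0 ?add0r.
Qed.

Lemma CX_tail n a : (forall i, CX (a i)) -> forall i, CX (tail n a i).
Proof. by move=> ca i; rewrite /tail; case: ltnP => // _; exact: CX_cst. Qed.

Lemma ss_tailE N a x m n : (N <= m)%N -> ss ((tail N a)^~ x) m n = ss (a^~ x) m n.
Proof.
move=> Nm; apply: eq_big_nat => i /andP[mi _].
by rewrite /tail ltnNge (leq_trans Nm mi).
Qed.

Lemma l2bd_tailseq N a x K : (forall n, ss (a^~ x) N n <= K ^+ 2) ->
  l2bd K ((tail N a)^~ x).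
Proof.
move=> h n; have [Nn|/ltnW nN] := leqP N n.
  rewrite (@ss_cat _ _ 0 N) ?Nn // (ss_tailE _ _ _ (leqnn N)) {1}/ss big_nat big1 ?add0r // => i.
  by rewrite /tail => /= ->; rewrite nc0 expr0n.
rewrite /ss big_nat big1 ?sqr_ge0 // => i /= ilt.
by rewrite /tail (leq_trans ilt nN) nc0 expr0n.
Qed.

Lemma l2_tail n a : l2 a -> l2 (tail n a).
Proof.
move=> /l2P[ca h]; apply/l2P; split=> [|e /h[N HN]]; first exact: CX_tail.
exists (maxn n N) => x k; rewrite ss_tailE ?leq_maxl //.
by apply: le_trans (HN x k); apply: ss_le => //; exact: leq_maxr.
Qed.

Section FunctionalDual.
Variables (K : R) (tau : seqX).
Hypotheses (K0 : 0 <= K) (tauK : bdseq K tau).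

Lemma functional_cvg a x : l2 a ->
  (fun n => \sum_(i < n) tau i x * a i x) @ \oo --> functional tau a x.
Proof.
by move=> la; have [L L0 aL] := l2_l2bd x la; exact: pairing_cvg (tauK.2 x) aL.
Qed.

(** The finite sums converge uniformly on [X]: the tails of [a] are uniformly small, those of [tau]
    uniformly bounded. *)
Lemma functional_CX a : l2 a -> CX (functional tau a).
Proof.
move=> la; apply: CX_ulim => e e0.
have K1 : 0 < K + 1 by rewrite ltr_wpDl.
have d0 : 0 < e / (K + 1) by rewrite divr_gt0.
have [N HN] := ((l2P a).1 la).2 _ (exprn_gt0 2 d0).
exists (fun x => \sum_(i < N) tau i x * a i x).
  apply: (CX_sum (F := fun i x => tau i x * a i x)) => i.
  by apply: CXM; [exact: tauK.1 | exact: l2_CX].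
move=> x; have [L L0 aL] := l2_l2bd x la.
apply: le_trans (pairing_tail (tauK.2 x) aL K0 (ltW d0) _ (HN x)) _ => [n|].
  exact: ss_le_l2bd (tauK.2 x).
by rewrite mulrA ler_pdivrMr // mulrC ler_wpM2l // ?ltW //; lra.
Qed.

Lemma functional_dual_normle : dual_normle (functional tau) K%:C%C.
Proof.
split=> [|a M la aM x]; first by rewrite lecR.
have [r r0 rM] := ge0_realC aM.1; move: aM; rewrite rM => /(l2_normleP la r0) ar.
by rewrite -rmorphM normE lecR; exact: pairing_le K0 r0 (tauK.2 x) (ar x).
Qed.

Lemma functional_dual : dual (functional tau).
Proof.
split.
- exact: functional_CX.
- move=> a b la lb; apply/funext => x; apply: pairing_lim.
  under eq_fun do under eq_bigr do rewrite mulrDr.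
  under eq_fun do rewrite big_split.
  by apply: cvgD; exact: functional_cvg.
- move=> a c la cc; apply/funext => x; apply: pairing_lim.
  under eq_fun do under eq_bigr do rewrite mulrA.
  under eq_fun do rewrite -mulr_suml.
  by apply: cvgM; [exact: functional_cvg | exact: cvg_cst].
- by exists K%:C%C; exact: functional_dual_normle.
Qed.

End FunctionalDual.

Section Representation.
Variable t : seqX -> X -> C.
Hypothesis dt : dual t.

Let coord : seqX := fun i => t (delta i).

Lemma dual_trunc n a x : (forall i, CX (a i)) ->
  t (trunc n a) x = \sum_(i < n) t (delta i) x * a i x.
Proof.
have [_ tD tZ _] := dt; move=> ca; elim: n => [|n IH].
  (* Presenting the zero sequence as a multiple by the zero function lets C(X)-linearity give the
     value 0. *)
  have -> : trunc 0 a = seq_act (delta 0) (fun _ => 0).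
    by apply/funext => i; apply/funext => y; rewrite trunc0 /seq_act mulr0.
  rewrite tZ; [by rewrite big_ord0 mulr0 | exact: l2_delta | exact: CX_cst].
rewrite truncS tD; last 2 first.
- exact: l2_trunc.
- apply: (l2_fin (N := n.+1)) => [i|i ni].
    by apply: CXM; [exact: CX_delta | exact: ca].
  by apply/funext => y; rewrite /seq_act /delta ltn_eqF // mul0r.
rewrite IH tZ; [by rewrite big_ord_recr | exact: l2_delta | exact: ca].
Qed.

(** [t] agrees with the finite sum on a truncation of [a], and the remaining tail has small norm in
    l_2(C(X)), so boundedness of [t] controls the error. *)
Lemma dual_functional a : l2 a -> t a = functional coord a.
Proof.
move=> la; apply/funext => x; apply/esym/pairing_lim/cvgCP => e e0.
have [_ tD _ [_ [/ge0_realC[K K0 ->] tK]]] := dt.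
have ca i : CX (a i) by exact: l2_CX.
have K1 : 0 < K + 1 by rewrite ltr_wpDl.
have d0 : 0 < e / (K + 1) by rewrite divr_gt0.
have [N HN] := ((l2P a).1 la).2 _ (exprn_gt0 2 d0).
exists N => n Nn; have lt := l2_tail n la.
have tn : l2_normle (tail n a) (e / (K + 1))%:C%C.
  apply/(l2_normleP lt (ltW d0)) => y; apply: l2bd_tailseq => k.
  by apply: le_trans (HN y k); exact: ss_le.
rewrite ncB {1}(trunc_tail n a) tD; [|exact: l2_trunc|exact: lt].
rewrite dual_trunc; last exact: ca.
rewrite addrAC subrr add0r.
have := tK _ _ lt tn x; rewrite normE -rmorphM lecR => /le_trans; apply.
by rewrite mulrA ler_pdivrMr // mulrC ler_wpM2l // ?ltW //; lra.
Qed.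

(* The bound at [x0] comes from testing [t] on the sequence of constants
   [(t e_i)(x0)^*], i < n. *)
Lemma dual_bdseq K : 0 <= K -> dual_normle t K%:C%C -> bdseq K coord.
Proof.
move=> K0 [_ tK]; have [tC _ _ _] := dt; split=> [i|x0 n]; first exact/tC/l2_delta.
pose a : seqX := trunc n (fun i _ => (coord i x0)^*).
have la : l2 a by apply: l2_trunc => i; exact: CX_cst.
have cst y : ss (a^~ y) 0 n = ss (coord^~ x0) 0 n.
  by apply: eq_big_nat => i /= ilt; rewrite /a /trunc ilt nc_conj.
set s := ss _ 0 n in cst *.
have s0 : 0 <= s by exact: ss_ge0.
have an : l2_normle a (Num.sqrt s)%:C%C.
  apply/(l2_normleP la (sqrtr_ge0 _)) => y k; rewrite sqr_sqrtr //.
  have [kn|/ltnW nk] := leqP k n; first by rewrite -(cst y); exact: ss_le.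
  rewrite (@ss_cat _ _ 0 n) ?nk // cst [X in _ + X]big_nat big1 ?addr0 // => i.
  by move=> /andP[ni _]; rewrite /a /trunc ltnNge ni nc0 expr0n.
have := tK _ _ la an x0; rewrite dual_trunc => [|i]; last exact: CX_cst.
rewrite normE -rmorphM lecR.
under eq_bigr do rewrite mulrC.
rewrite (sum_conj_mul (coord^~ x0)) -/s nc_real ger0_norm // => h.
exact: le_sqr_sqrt.
Qed.

End Representation.
End Dual.

Arguments delta {R X} i _ _.

(** * Bounded functionals on the dual *)

Section CompactUrysohn.
Variables (R : realType) (X : topologicalType).

(** A compact Hausdorff space is normal, hence completely regular; [c] is [1 - f] for [f] separating
    [x] from the complement of the interior of [U]. *)
Lemma bump (x : X) (U : set X) : hausdorff_space X -> compact [set: X] -> nbhs x U ->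
  exists c : X -> R, [/\ continuous c, forall y, 0 <= c y <= 1, c x = 1 &
    forall y, c y != 0 -> U y].
Proof.
move=> hX cX /nbhs_interior Ux.
have cr : completely_regular_space X.
  apply: (@normal_completely_regular R); first exact: compact_normal.
  exact: hausdorff_accessible.
case: (cr x (~` U°)).
- by apply: open_closedC; exact: open_interior.
- by move=> /(_ (nbhs_singleton Ux)).
move=> uT sep.
have /(@uniform_separatorP _ R)[f [cf f01 f0 f1]] :
  uniform_separator [set x] (~` U°) by exists uT.
have f0x : f x = 0 by apply: f0; exists x.
exists (fun y => 1 - f y); split.
- by move=> y; apply: cvgB; [exact: cvg_cst | exact: cf].
- move=> y; have := f01 (f y); rewrite /= in_itv /= => /(_ _)/andP[|h0 h1].
    by exists y.
  by rewrite subr_ge0 h1 lerBlDr lerDl h0.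
- by rewrite f0x subr0.
- move=> y cy; apply: interior_subset; apply: contrapT => Uy.
  by move: cy; rewrite (f1 (f y)) ?subrr ?eqxx //; exists y.
Qed.

End CompactUrysohn.

(** * The second dual in coordinates *)

Section Bidual.
Variables (R : realType) (X : topologicalType).
Local Notation C := (Cplx R).
Local Notation seqX := (seqX R X).
Implicit Types (a tau sigma : seqX) (t s : seqX -> X -> C) (c : X -> C).
Implicit Types (K L e : R) (m n N : nat) (x : X).

Lemma dual_act_dual t c A : dual t -> CX c -> 0 <= A -> (forall x, nc (c x) <= A) ->
  dual (dual_act t c).
Proof.
move=> [tC tD tZ [_ [/ge0_realC[K K0 ->] tK]]] cc A0 cA; split.
- by move=> a la; apply: CXM; [exact: CX_conj | exact: tC].
- by move=> a b la lb; apply/funext => x; rewrite /dual_act tD // mulrDr.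
- by move=> a d la cd; apply/funext => x; rewrite /dual_act tZ // mulrA.
- exists (A * K)%:C%C; split=> [|a M la aM x]; first by rewrite lecR mulr_ge0.
  have := tK _ _ la aM x; have [M' M0 ->] := ge0_realC aM.1.
  rewrite !normE -!rmorphM !lecR ncM nc_conj -mulrA => h.
  by apply: ler_pM; rewrite ?nc_ge0.
Qed.

Lemma bdseq_delta i : bdseq 1 (delta i : seqX).
Proof.
split=> [j|x n]; first exact: CX_delta.
have [le|gt] := leqP n i.
  rewrite /ss big_nat big1 ?sqr_ge0 // => j /= jn.
  by rewrite /delta gtn_eqF ?(leq_trans jn) // nc0 expr0n.
rewrite /ss big_mkord (bigD1 (Ordinal gt)) //= big1 ?addr0 => [|j].
  by rewrite /delta eqxx /nc /= expr1n expr0n addr0 sqrtr1 !expr1n.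
by rewrite -val_eqE /= eq_sym /delta => /negPf ->; rewrite nc0 expr0n.
Qed.

Lemma bdseqD K L tau sigma : 0 <= K -> 0 <= L -> bdseq K tau -> bdseq L sigma ->
  bdseq (2 * (K + L)) (seq_add tau sigma).
Proof.
move=> K0 L0 [ct ht] [cs hs]; split=> [i|x]; first exact: CXD.
exact: l2bdD (ht x) (hs x).
Qed.

Lemma bdseqZ K A tau c : 0 <= K -> bdseq K tau -> CX c -> (forall x, nc (c x) <= A) ->
  bdseq (K * A) (seq_act tau c).
Proof.
move=> K0 [ct ht] cc cA; split=> [i|x]; first by apply: CXM; [exact: ct | exact: cc].
exact: l2bdZ (cA x) (ht x).
Qed.

Lemma bdseq_trunc K n tau : 0 <= K -> bdseq K tau -> bdseq K (trunc n tau).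
Proof.
move=> K0 [ct ht]; split=> [|x m]; first exact: CX_trunc.
apply: le_trans (ht x m); apply: ler_sum => i _; rewrite /trunc.
by case: ltnP => // _; rewrite nc0 expr0n sqr_ge0.
Qed.

Lemma bdseq_nc K tau i x : 0 <= K -> bdseq K tau -> nc (tau i x) <= K.
Proof.
move=> K0 [_ /(_ x)/(@ss_le_l2bd _ _ _ i i.+1)].
by rewrite /ss big_nat1 ler_sqr ?nnegrE ?nc_ge0.
Qed.

(* The sum [sum_i |tau_i|^2] is only lower semicontinuous; a point of [U] where
   a partial sum comes within [e] of the supremum over [U] has a neighbourhood
   on which the remaining tail is at most [e]. *)
Lemma tail_small_somewhere K tau x0 (U : set X) e : bdseq K tau -> nbhs x0 U -> 0 < e ->
  exists2 x, U x & exists N, \forall y \near x, forall n, ss (tau^~ y) N n <= e.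
Proof.
move=> [ct ht] /nbhs_interior/nbhs_singleton U0 e0.
pose E := [set r | exists x n, U° x /\ ss (tau^~ x) 0 n = r].
have supE : has_sup E.
  split; first by exists (ss (tau^~ x0) 0 0), x0, 0%N.
  by exists (K ^+ 2) => _ [x [n [_ <-]]]; exact: ht.
have [_ [x [N [Ux <-]]] HN] := sup_adherent e0 supE.
exists x; first exact: interior_subset.
exists N; near=> y => n; have [Nn|/ltnW nN] := leqP N n; last first.
  by rewrite /ss big_geq // ltW.
have : ss (tau^~ y) 0 n <= sup E.
  apply: ub_le_sup; first by case: supE.
  exists y, n; split=> //; near: y; apply: open_nbhs_nbhs; split=> //.
  exact: open_interior.
have : sup E - e < ss (tau^~ y) 0 N by near: y; exact: CX_ss.
rewrite (@ss_cat _ _ 0 N n) ?Nn //; lra.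
Unshelve. all: by end_near. Qed.

Section Coordinates.
Variable F : (seqX -> X -> C) -> X -> C.
Hypothesis bF : bidual F.

Let Phi tau := F (functional tau).

(* Elements of the dual are total functions on sequences, so two of them may
   differ outside l_2; their difference has norm 0, hence [F] does not see it. *)
Lemma bidual_ext t s : dual t -> dual s -> (forall a, l2 a -> t a = s a) -> F t = F s.
Proof.
move=> dt ds ts; pose d : seqX -> X -> C := fun a x => t a x - s a x.
have d0 a : l2 a -> d a = fun _ => 0.
  by move=> la; apply/funext => x; rewrite /d ts // subrr.
have [tC tD tZ _] := dt; have [sC sD sZ _] := ds.
have dnorm : dual_normle d 0.
  by split=> // a M la [M0 _] x; rewrite d0 // normr0 mul0r.
have dd : dual d.
  split; last by exists 0.
  - by move=> a la; rewrite d0 //; exact: CX_cst.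
  - by move=> a b la lb; apply/funext => x; rewrite /d tD // sD // opprD addrACA.
  - by move=> a c la cc; apply/funext => x; rewrite /d tZ // sZ // mulrBl.
have -> : t = dual_add s d.
  by apply/funext => a; apply/funext => x; rewrite /dual_add /d addrC subrK.
have [_ FD _ [L [L0 FL]]] := bF; rewrite FD //; apply/funext => x.
have := FL d 0 dd dnorm x; rewrite mulr0 normr_le0 => /eqP ->.
by rewrite addr0.
Qed.

Lemma Phi_CX K tau : 0 <= K -> bdseq K tau -> CX (Phi tau).
Proof.
by move=> K0 tK; have [FC _ _ _] := bF; apply: FC; exact: functional_dual tK.
Qed.

Lemma Phi_bounded : exists2 L, 0 <= L & forall K tau x, 0 <= K -> bdseq K tau ->
  nc (Phi tau x) <= L * K.
Proof.
have [_ _ _ [_ [/ge0_realC[L L0 ->] FL]]] := bF; exists L => // K tau x K0 tK.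
have := FL _ _ (functional_dual K0 tK) (functional_dual_normle K0 tK) x.
by rewrite normE -rmorphM lecR.
Qed.

Lemma PhiD K L tau sigma : 0 <= K -> 0 <= L -> bdseq K tau -> bdseq L sigma ->
  Phi (seq_add tau sigma) = fun x => Phi tau x + Phi sigma x.
Proof.
move=> K0 L0 tK sL; have [_ FD _ _] := bF.
have dt := functional_dual K0 tK; have ds := functional_dual L0 sL.
rewrite -FD //; have KL0 : 0 <= 2 * (K + L) by rewrite mulr_ge0 ?addr_ge0.
have dD := functional_dual KL0 (bdseqD K0 L0 tK sL).
have eqD a : l2 a -> functional (seq_add tau sigma) a =
    dual_add (functional tau) (functional sigma) a.
  move=> la; apply/funext => x; apply: pairing_lim.
  under eq_fun do under eq_bigr do rewrite mulrDl.
  under eq_fun do rewrite big_split.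
  by apply: cvgD; [exact: (functional_cvg tK) | exact: (functional_cvg sL)].
apply: bidual_ext => //.
have [tC tDD tZ [_ [/ge0_realC[Mt Mt0 ->] tM]]] := dt.
have [sC sDD sZ [_ [/ge0_realC[Ms Ms0 ->] sM]]] := ds; split.
- by move=> a la; apply: CXD; [exact: tC | exact: sC].
- by move=> a b la lb; apply/funext => x; rewrite /dual_add tDD // sDD // addrACA.
- by move=> a c la cc; apply/funext => x; rewrite /dual_add tZ // sZ // mulrDl.
- exists (Mt + Ms)%:C%C; split=> [|a B la aB x]; first by rewrite lecR addr_ge0.
  apply: le_trans (ler_normD _ _) _; rewrite rmorphD mulrDl.
  by apply: lerD; [exact: tM | exact: sM].
Qed.

(** The conjugate comes from Paschke's action on the dual: multiplying [tau] by the conjugate of [c]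
    is acting by [c] on [functional tau], at least on l_2, and [bidual_ext] covers the rest. *)
Lemma PhiZ K A tau c : 0 <= K -> 0 <= A -> bdseq K tau -> CX c ->
  (forall x, nc (c x) <= A) ->
  Phi (seq_act tau (fun x => (c x)^*)) = fun x => Phi tau x * c x.
Proof.
move=> K0 A0 tK cc cA; have [_ _ FZ _] := bF.
have dt := functional_dual K0 tK; rewrite -FZ //.
apply: bidual_ext.
- apply: (functional_dual (K := K * A)); first exact: mulr_ge0.
  apply: bdseqZ K0 tK _ _ => [|x]; last by rewrite nc_conj; exact: cA.
  by apply: CX_conj; exact: cc.
- exact: dual_act_dual A0 cA.
- move=> a la; apply/funext => x; apply: pairing_lim.
  under eq_fun do under eq_bigr do rewrite /seq_act mulrAC mulrC.
  under eq_fun do rewrite -mulr_sumr.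
  by apply: cvgM; [exact: cvg_cst | exact: (functional_cvg tK)].
Qed.

Let phi : seqX := fun i => Phi (delta i).

Lemma Phi_trunc K n tau x : 0 <= K -> bdseq K tau ->
  Phi (trunc n tau) x = \sum_(i < n) phi i x * (tau i x)^*.
Proof.
move=> K0 tK; elim: n => [|n IH].
  (* The zero sequence satisfies [bdseq 0], so the bound on [Phi] makes its value 0. *)
  rewrite big_ord0; apply: nc_le0; have [L L0 PL] := Phi_bounded.
  rewrite -[leRHS](mulr0 L); apply: PL => //; split=> [i|y m].
    exact: CX_cst.
  by rewrite /ss big1 ?sqr_ge0 // => i _; rewrite trunc0 nc0 expr0n.
have b1 : bdseq (1 * K) (seq_act (delta n) (tau n)).
  by apply: bdseqZ => //; [exact: bdseq_delta | exact: tK.1 | move=> y; exact: bdseq_nc tK].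
have mK : 0 <= 1 * K by rewrite mul1r.
rewrite truncS (PhiD K0 mK (bdseq_trunc n K0 tK) b1) IH big_ord_recr /=; congr (_ + _).
have -> : tau n = fun y => ((tau n y)^*)^* by apply/funext => y; rewrite conjCK.
rewrite (PhiZ ler01 K0 (bdseq_delta n)).
- by rewrite conjCK.
- by apply: CX_conj; exact: tK.1.
- by move=> y; rewrite nc_conj; exact: bdseq_nc tK.
Qed.

(** Testing [F] on the constants [phi i x0], [i < n], a sequence of norm [Num.sqrt s], yields
    [s <= L * Num.sqrt s] at [x0]. The same [L] bounds both [phi] and [F]. *)
Lemma phi_bdseq : exists2 L, 0 <= L & bdseq L phi /\
  forall K tau x, 0 <= K -> bdseq K tau -> nc (Phi tau x) <= L * K.
Proof.
have [L L0 PL] := Phi_bounded; exists L => //; split=> //; split=> [i|x0 n].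
  by apply: (Phi_CX ler01); exact: bdseq_delta.
pose cst : seqX := fun i _ => if (i < n)%N then phi i x0 else 0.
set s := ss _ 0 n; have s0 : 0 <= s by exact: ss_ge0.
have cn : bdseq (Num.sqrt s) cst.
  split=> [i|y k]; first exact: CX_cst.
  rewrite sqr_sqrtr //.
  have kE m : (m <= n)%N -> ss (cst^~ y) 0 m = ss (phi^~ x0) 0 m.
    by move=> mn; apply: eq_big_nat => i /= im; rewrite /cst (leq_trans im mn).
  have [kn|/ltnW nk] := leqP k n; first by rewrite kE //; exact: ss_le.
  rewrite (@ss_cat _ _ 0 n) ?nk // kE // [X in _ + X]big_nat big1 ?addr0 // => i.
  by move=> /andP[ni _]; rewrite /cst ltnNge ni nc0 expr0n.
have r0 := sqrtr_ge0 s; have := PL _ _ x0 r0 (bdseq_trunc n r0 cn).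
rewrite (Phi_trunc n x0 r0 cn).
under eq_bigr => i do rewrite /cst ltn_ord mulrC.
rewrite (sum_conj_mul (phi^~ x0)) -/s nc_real ger0_norm // => h.
exact: le_sqr_sqrt.
Qed.

(* [F] commutes with multiplication by a bump function at [x], so only the size
   of the tail of [tau] near [x] matters. *)
Lemma Phi_local L K e N tau x (c : X -> R) :
  (forall K tau x, 0 <= K -> bdseq K tau -> nc (Phi tau x) <= L * K) ->
  0 <= K -> 0 <= e -> bdseq K tau ->
  continuous c -> (forall y, 0 <= c y <= 1) -> c x = 1 ->
  (forall y, c y != 0 -> forall n, ss (tau^~ y) N n <= e ^+ 2) ->
  nc (Phi tau x - \sum_(i < N) phi i x * (tau i x)^*) <= L * e.
Proof.
move=> PL K0 e0 tK cc c01 cx h; pose d y : C := (c y)%:C%C.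
have cd : CX d by exact: CX_real.
have d1 y : nc (d y) <= 1.
  by rewrite nc_real; have /andP[c0 c1] := c01 y; rewrite ger0_norm.
have dJ : (fun y => (d y)^*) = d by apply/funext => y; exact: realC_conj.
have := PhiZ K0 ler01 tK cd d1; rewrite dJ; set sigma := seq_act tau d => PE.
have sK : bdseq K sigma by rewrite -[K]mulr1; exact: bdseqZ.
have se : bdseq e (tail N sigma).
  split=> [|y]; first by apply: CX_tail; exact: sK.1.
  apply: l2bd_tailseq => n; have [c0|/h/(_ n)] := eqVneq (c y) 0.
    by rewrite /ss big1 ?sqr_ge0 // => i _; rewrite /sigma /seq_act /d c0 mulr0 nc0 expr0n.
  apply: le_trans; apply: ler_sum => i _; rewrite ncM ler_sqr ?nnegrE ?mulr_ge0 ?nc_ge0 //.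
  by rewrite ler_piMr ?nc_ge0.
have dx : d x = 1 by rewrite /d cx.
(* Passing to [sigma] keeps the value at [x], while its tail is now small on all of [X]. *)
have -> : Phi tau x = Phi sigma x by rewrite PE dx mulr1.
rewrite {1}(trunc_tail N sigma) (PhiD K0 e0 (bdseq_trunc N K0 sK) se).
rewrite (Phi_trunc N x K0 sK).
under eq_bigr => i do rewrite /sigma /seq_act dx mulr1.
by rewrite addrAC subrr add0r; exact: PL.
Qed.

End Coordinates.
End Bidual.

(** * A copy of beta N from a non-uniformly convergent square sum *)

Section BetaNEmbedding.
Variables (X : topologicalType) (x : nat -> X).
Hypotheses (hX : hausdorff_space X) (cX : compact [set: X]).
Hypothesis sep : forall S : set nat, closure (x @` S) `&` closure (x @` (~` S)) = set0.

Lemma betaN_eq (p q : betaN) : bn_filter p = bn_filter q -> p = q.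
Proof.
case: p q => [p up] [q uq] /= pq; case: q / pq uq => uq.
by rewrite (Prop_irrelevance up uq).
Qed.

Lemma betaN_setC (p : betaN) A : ~ bn_filter p A -> bn_filter p (~` A).
Proof.
have := bn_ultra p => U pA.
by have [|//] := in_ultra_setVsetC A U.
Qed.

Lemma betaN_base_open A : open (betaN_base A).
Proof. by exists [set A] => //; rewrite bigcup_set1. Qed.

(** Compactness gives a cluster point of the image ultrafilter, and an ultrafilter converges to its
    cluster points. *)
Lemma betaN_lim_ex (p : betaN) : exists y : X, x @ bn_filter p --> y.
Proof.
have := bn_ultra p => U.
have /cX[|y [_ cy]] : ProperFilter (fmap x (bn_filter p)) by exact: fmap_proper_filter.
   exact: filterT.
exists y => V yV; apply: contrapT => /betaN_setC pV.
by have [z [zV Vz]] := cy (~` V) V pV yV.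
Qed.

Definition betaN_lim (p : betaN) : X := projT1 (cid (betaN_lim_ex p)).

Lemma betaN_limP p : x @ bn_filter p --> betaN_lim p.
Proof. exact: projT2 (cid (betaN_lim_ex p)). Qed.

Lemma betaN_lim_eq p (y : X) : x @ bn_filter p --> y -> betaN_lim p = y.
Proof.
have := bn_ultra p => U; move=> h.
by apply: (cvg_unique hX) h; exact: betaN_limP.
Qed.

Lemma betaN_lim_closure p A : bn_filter p A -> closure (x @` A) (betaN_lim p).
Proof.
have := bn_ultra p => U pA B /betaN_limP pB.
have /filter_ex[n [An Bn]] : bn_filter p (A `&` x @^-1` B) by exact: filterI.
by exists (x n); split=> //; exists n.
Qed.

(** By [sep] the limit point determines the ultrafilter; this gives both injectivity and openness
    onto the image. *)
Lemma betaN_lim_mem p A : bn_filter p A <-> ~ closure (x @` (~` A)) (betaN_lim p).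
Proof.
split=> [pA cA|h].
  by have : set0 (betaN_lim p) by rewrite -(sep A); split=> //; exact: betaN_lim_closure.
by apply: contrapT => /betaN_setC/betaN_lim_closure.
Qed.

Lemma betaN_embeds : exists F : set X, closed F /\ homeomorphic_to_subset betaN F.
Proof.
exists (betaN_lim @` setT); split.
  have -> : betaN_lim @` setT = closure (range x); last exact: closed_closure.
  apply/seteqP; split=> [_ [p _ <-]|y yx].
    by apply: betaN_lim_closure; have := bn_ultra p => U; exact: filterT.
  (* An ultrafilter refining the trace on [nat] of the neighbourhoods of [y] has limit [y]. *)
  pose G := filter_from (nbhs y) (fun B => x @^-1` B).
  have PG : ProperFilter G.
    apply: filter_from_proper => [|B /yx[_ [[n _ <-] Bn]]]; last by exists n.
    apply: filter_from_filter; first by exists setT; exact: filterT.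
    by move=> A B yA yB; exists (A `&` B) => //; exact: filterI.
  have [H [UH GH]] := ultraFilterLemma PG.
  exists (BetaN UH) => //; apply: betaN_lim_eq => B yB /=.
  by apply: GH; exists B.
exists betaN_lim; split=> //.
- move=> p q pq; apply: betaN_eq; apply/seteqP; split=> A /betaN_lim_mem h;
    by apply/betaN_lim_mem; move: h; rewrite pq.
(* By regularity [V] contains the closure of a neighbourhood [W]; every ultrafilter containing the
   preimage of [W] has its limit in that closure. *)
- move=> p V /= /(compact_regular hX cX (filterT))[W pW WV].
  apply: (@filterS _ _ _ (betaN_base (x @^-1` W))).
    move=> q /betaN_lim_closure h; apply: WV.
    by apply: closureS h => _ [n Wn <-].
  apply: open_nbhs_nbhs; split; first exact: betaN_base_open.
  exact: betaN_limP.
(* [U] is a union of basic sets, and [betaN_lim_mem] turns each into the trace of an open set. *)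
- move=> U [D _ <-]; exists (\bigcup_(A in D) ~` closure (x @` (~` A))); split.
    by apply: bigcup_open => A _; apply: closed_openC; exact: closed_closure.
  apply/seteqP; split=> [_ [p [A DA pA] <-]|y [[A DA /= h] [p _ pE]]].
    by split; [exists A => //; exact/betaN_lim_mem | exists p].
  exists p => //; exists A => //; apply/betaN_lim_mem.
  by rewrite pE.
Qed.

End BetaNEmbedding.

(** * Disjoint blocks of large square sums *)

Section NonUniformTails.
Variables (R : realType) (X : topologicalType) (phi : seqX R X) (L d : R).
Hypotheses (hX : hausdorff_space X) (cX : compact [set: X]).
Hypotheses (phiL : forall x, l2bd L (phi^~ x)) (d0 : 0 < d).
Hypothesis nonunif : forall N, exists x n, d < ss (phi^~ x) N n.

(** The nonempty sets [E N] decrease with [N], so they generate a proper filter, which clusters by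
    compactness. *)
Lemma nonuniform_cluster : exists p : X, forall N V, nbhs p V ->
  exists x n, V x /\ d < ss (phi^~ x) N n.
Proof.
pose E N := [set x | exists n, d < ss (phi^~ x) N n].
pose G := filter_from setT E.
have PG : ProperFilter G.
  apply: filter_from_proper => [|N _]; last by have [x [n h]] := nonunif N; exists x, n.
  apply: filter_from_filter; first by exists 0%N.
  move=> M N _ _; exists (maxn M N) => // x [n h].
  by split; exists n; apply: lt_le_trans h _; apply: ss_le; rewrite ?leq_maxl ?leq_maxr.
have [|p [_ cp]] := cX PG; first exact: filterT.
exists p => N V pV; have [|x [[n h] Vx]] := cp (E N) V _ pV; first by exists N.
by exists x, n.
Qed.

(* A cluster point [p] of the points with large tails is kept in a shrinking
   neighbourhood; as the tails at [p] itself are small, each new point differs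
   from [p] and can be separated from it. *)
Lemma disjoint_blocks : exists (x : nat -> X) (U : nat -> set X) (N : nat -> nat),
  [/\ forall j, nbhs (x j) (U j),
      forall j k y, U j y -> U k y -> j = k,
      forall j k, (j <= k)%N -> (N j <= N k)%N &
      forall j, d < ss (phi^~ (x j)) (N j) (N j.+1)].
Proof.
have [p cp] := nonuniform_cluster; have [N0 HN0] := ss_tail (phiL p) d0.
(* A state holds the index reached and a neighbourhood of [p]; a step outputs a point with its
   neighbourhood, and the next state. *)
pose ok (s : nat * set X) := (N0 <= s.1)%N /\ nbhs p s.2.
pose next (s : nat * set X) (r : (X * set X) * (nat * set X)) :=
  [/\ ok r.2, (s.1 <= r.2.1)%N /\ d < ss (phi^~ r.1.1) s.1 r.2.1,
      nbhs r.1.1 r.1.2, r.1.2 `<=` s.2 /\ r.2.2 `<=` s.2 &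
      r.1.2 `&` r.2.2 = set0].
have step s : exists r, ok s -> next s r.
  have [oks|nok] := pselect (ok s); last by exists ((p, set0), s).
  have [N0s ps] := oks.
  have [x [n [sx h]]] := cp s.1 s.2° (nbhs_interior ps).
  have xp : x != p.
    apply/eqP => xp; move: h; rewrite xp ltNge => /negP; apply.
    by apply: le_trans (HN0 n); exact: ss_le.
  have := hX; rewrite open_hausdorff => /(_ _ _ xp)[[A B] /= [/set_mem Ax /set_mem Bp]].
  move=> [oA oB /eqP AB].
  (* All later neighbourhoods lie in [B], hence avoid [A]; [maxn] keeps the indices monotone. *)
  exists ((x, A `&` s.2), (maxn s.1 n, B `&` s.2)) => _; split=> /=.
  - split; first by rewrite /= (leq_trans N0s) // leq_maxl.
    by apply: filterI => //; exact: open_nbhs_nbhs.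
  - split; first exact: leq_maxl.
    by apply: lt_le_trans h _; apply: ss_le => //; exact: leq_maxr.
  - apply: filterI; first exact: open_nbhs_nbhs.
    exact: sx.
  - by split=> y [].
  - by rewrite setIACA AB set0I.
have [f fP] := choice step.
pose st j := iter j (fun s => (f s).2) (N0, setT).
have okst j : ok (st j).
  elim: j => [|j IH]; first by split=> //; exact: filterT.
  by have [] := fP _ IH.
have nx j : next (st j) (f (st j)) by exact: fP.
have mono j k : (j <= k)%N -> ((st j).1 <= (st k).1)%N /\ (st k).2 `<=` (st j).2.
  move=> /subnK <-; elim: (k - j)%N => [|i [IH1 IH2]]; first by split.
  rewrite addSn; have [_ [h1 _] _ [_ h2] _] := nx (i + j)%N; split.
    exact: leq_trans IH1 h1.
  by apply: subset_trans IH2; exact: h2.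
have disj j k y : (j < k)%N -> (f (st j)).1.2 y -> ~ (f (st k)).1.2 y.
  move=> jk jy ky; have [_ _ _ _ h] := nx j.
  suff : set0 y by []; rewrite -h; split=> //.
  have [_ /(_ y)] := mono _ _ jk; apply.
  by have [_ _ _ [hk _] _] := nx k; exact: hk.
exists (fun j => (f (st j)).1.1), (fun j => (f (st j)).1.2), (fun j => (st j).1).
split=> [j|j k y jy ky|j k jk|j].
- by have [] := nx j.
- have [jk|kj|//] := ltngtP j k; first by case: (disj _ _ _ jk jy ky).
  by case: (disj _ _ _ kj ky jy).
- by have [] := mono _ _ jk.
- by have [_ []] := nx j.
Qed.

End NonUniformTails.

(** * Reflexivity *)

Section Reflexivity.
Variables (R : realType) (X : topologicalType).
Hypotheses (hX : hausdorff_space X) (cX : compact [set: X]).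
Local Notation C := (Cplx R).
Local Notation seqX := (seqX R X).
Variable F : (seqX -> X -> C) -> X -> C.
Hypothesis bF : bidual F.

Let phi : seqX := fun i => F (functional (delta i)).

(** * Functionals supported on selected blocks *)

Section SeparatingFunctionals.
Variables (L d : R) (x : nat -> X) (c : nat -> X -> R) (N : nat -> nat).
Hypotheses (L0 : 0 <= L) (phiL : bdseq L phi) (d0 : 0 < d).
Hypothesis FL : forall K tau x, 0 <= K -> bdseq K tau ->
  nc (F (functional tau) x) <= L * K.
Hypotheses (cc : forall j, continuous (c j)) (c01 : forall j y, 0 <= c j y <= 1)
  (cx : forall j, c j (x j) = 1)
  (cdisj : forall j k y, c j y != 0 -> c k y != 0 -> j = k)
  (Nmono : forall j k, (j <= k)%N -> (N j <= N k)%N)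
  (Nd : forall j, d < ss (phi^~ (x j)) (N j) (N j.+1)).

(** An index in no block, such as one below [N 0], gets the default 0, hence the second test in
    [block_seq]. *)
Let block i := xget 0%N [set j | (N j <= i < N j.+1)%N].

Lemma blockE i j : (N j <= i < N j.+1)%N -> block i = j.
Proof.
move=> ij; have : (N (block i) <= i < N (block i).+1)%N.
  by apply: (@xgetPex _ 0%N [set j | (N j <= i < N j.+1)%N]); exists j.
case/andP: ij; case: (ltngtP (block i) j) => // h h1 h2 /andP[h3 h4].
  by have := leq_trans h4 (leq_trans (Nmono h) h1); rewrite ltnn.
by have := leq_trans h2 (leq_trans (Nmono h) h3); rewrite ltnn.
Qed.

Definition block_seq (S : set nat) : seqX := fun i y =>
  if `[< S (block i) >] && (N (block i) <= i < N (block i).+1)%N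
  then (c (block i) y)%:C%C * phi i y else 0.

Lemma block_seq_bdseq S : bdseq L (block_seq S).
Proof.
split=> [i|y n].
  rewrite /block_seq; case: (`[< S (block i) >] && _); last exact: CX_cst.
  by apply: CXM; [exact: CX_real | exact: phiL.1].
apply: le_trans (phiL.2 y n); apply: ler_sum => i _; rewrite /block_seq.
case: ifP => _; last by rewrite nc0 expr0n sqr_ge0.
have /andP[h0 h1] := c01 (block i) y.
rewrite ncM nc_real ger0_norm // exprMn ler_piMl ?sqr_ge0 //.
by rewrite expr_le1.
Qed.

Lemma block_seqE S i j y : c j y != 0 -> block_seq S i y =
  if `[< S j >] && (N j <= i < N j.+1)%N then (c j y)%:C%C * phi i y else 0.
Proof.
move=> cj; rewrite /block_seq; have [<-//|bj] := eqVneq (block i) j.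
have [/blockE/eqP|_] := boolP (N j <= i < N j.+1)%N; first by rewrite (negPf bj).
rewrite andbF; case: ifP => // _.
suff -> : c (block i) y = 0 by rewrite mul0r.
by apply/eqP; apply: contraNT bj => /cdisj/(_ cj) ->.
Qed.

(** Where [c j] is nonzero the sequence vanishes from [N j.+1] on, so [Phi_local] with [e = 0] gives
    an exact finite sum. *)
Lemma bidual_block_seq S j : F (functional (block_seq S)) (x j) =
  if `[< S j >] then (ss (phi^~ (x j)) (N j) (N j.+1))%:C%C else 0.
Proof.
have cj : c j (x j) != 0 by rewrite cx oner_eq0.
have tail0 y : c j y != 0 -> forall n, ss ((block_seq S)^~ y) (N j.+1) n <= 0 ^+ 2.
  move=> cy n; rewrite /ss big_nat big1 ?sqr_ge0 // => i /andP[ni _].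
  by rewrite (block_seqE _ _ cy) ltnNge ni !andbF nc0 expr0n.
have := Phi_local bF FL L0 (lexx 0) (block_seq_bdseq S) (@cc j) (c01 j) (cx j) tail0.
rewrite mulr0 => /nc_le0/eqP; rewrite subr_eq0 => /eqP ->.
rewrite -(big_mkord xpredT (fun i => phi i (x j) * (block_seq S i (x j))^*)).
rewrite (big_cat_nat (leq0n (N j)) (Nmono (leqnSn j))) /= big_nat big1 ?add0r.
  rewrite big_nat.
  under eq_bigr => i hi do rewrite (block_seqE _ _ cj) hi andbT cx mul1r.
  rewrite -big_nat; case: asboolP => _; last first.
    by rewrite big1 // => i _; rewrite rmorph0 mulr0.
  by rewrite rmorph_sum /=; apply: eq_bigr => i _; exact: mulcJ.
by move=> i /= ij; rewrite (block_seqE _ _ cj) leqNgt ij andbF rmorph0 mulr0.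
Qed.

Lemma block_points_separated (S : set nat) :
  closure (x @` S) `&` closure (x @` (~` S)) = set0.
Proof.
rewrite -subset0 => y [yS yC].
(* With tolerance [d / 4], a common closure point would force a value above [d] to be within [d / 2]
   of 0. *)
have /CXP/(_ y _ (divr_gt0 d0 (ltr0Sn R 3))) := Phi_CX bF L0 (block_seq_bdseq S).
move=> h; have [_ [[j Sj <-] /= hj]] := yS _ h; have [_ [[k Sk <-] /= hk]] := yC _ h.
move: hj hk; rewrite !bidual_block_seq asboolT // asboolF // subr0.
set g := F _ y => hj hk; have := Nd j.
have := ncD ((ss (phi^~ (x j)) (N j) (N j.+1))%:C%C - g) g.
rewrite subrK nc_real ger0_norm ?ss_ge0 // (ncB _ g); move: hj hk d0; lra.
Qed.

End SeparatingFunctionals.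

Lemma phi_l2 : ~ (exists A : set X, closed A /\ homeomorphic_to_subset betaN A) ->
  l2 (fun i y => (phi i y)^*).
Proof.
move=> nb; have [L L0 [phiL FL]] := phi_bdseq bF.
apply/l2P; split=> [i|e e0]; first by apply: CX_conj; exact: phiL.1.
apply: contrapT => nonunif; apply: nb.
have [|x [U [N [xU disj Nmono Nd]]]] := disjoint_blocks hX cX phiL.2 e0.
  move=> N; apply: contrapT => h; apply: nonunif; exists N => x n.
  by rewrite ss_conj leNgt; apply/negP => h'; apply: h; exists x, n.
pose bump_at j (c : X -> R) := [/\ continuous c, forall y, 0 <= c y <= 1,
  c (x j) = 1 & forall y, c y != 0 -> U j y].
have [c cP] := @choice _ _ bump_at (fun j => bump R hX cX (xU j)).
apply: (@betaN_embeds X x hX cX).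
apply: (@block_points_separated L e x c N) => //.
- by move=> j; have [] := cP j.
- by move=> j; have [] := cP j.
- by move=> j; have [] := cP j.
- move=> j k y cj ck; have [_ _ _ cU] := cP j; have [_ _ _ cU'] := cP k.
  by apply: (disj j k y); [exact: cU | exact: cU'].
Qed.

(** If the continuous difference [h] had modulus [r > 0] at [x0], it would exceed [r / 2] nearby;
    but at some nearby point [tau] has small tails, and both sides are within [r / 4] of the same
    finite sum. *)
Lemma bidual_canon t : dual t -> l2 (fun i y => (phi i y)^*) ->
  F t = Defs.canon (fun i y => (phi i y)^*) t.
Proof.
move=> dt; set a : seqX := (X in l2 X) => la.
have [L L0 [phiL FL]] := phi_bdseq bF.
have [_ _ _ [KC tK0]] := dt; have [K K0 KE] := ge0_realC tK0.1; rewrite KE in tK0.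
have tK := dual_bdseq dt K0 tK0; set tau : seqX := fun i => t (delta i) in tK.
have FE : F t = F (functional tau).
  apply: (bidual_ext bF) => //; first exact: functional_dual tK.
  by move=> b lb; exact: dual_functional.
have tE : t a = functional tau a by exact: dual_functional.
pose h x := F t x - (t a x)^*.
have ch : CX h.
  have ct : CX (t a) by case: dt => tC _ _ _; exact: tC.
  have cF : CX (F t) by case: bF => FC _ _ _; exact: FC.
  rewrite /h; under eq_fun do rewrite -mulN1r.
  apply: CXD; first exact: cF.
  by apply: CXM; [exact: CX_cst | apply: CX_conj; exact: ct].
apply/funext => x0; rewrite /Defs.canon; apply/eqP; rewrite -subr_eq0; apply/eqP.
apply: nc_le0; rewrite leNgt; apply/negP => hx0; rewrite -/(h x0) in hx0.
set r := nc _ in hx0.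
have L1 : 0 < L + 1 by rewrite ltr_wpDl.
pose e := r / 4 / (L + 1); have e0 : 0 < e by rewrite !divr_gt0.
have eL : L * e <= r / 4.
  by rewrite /e mulrA ler_pdivrMr // mulrC ler_wpM2l ?divr_ge0 ?(ltW hx0) //; lra.
have rr : r / 2 < r by lra.
have [x Ux [N]] := tail_small_somewhere tK (CX_lt ch rr) (exprn_gt0 2 e0).
move=> /(bump R hX cX)[c [cc c01 cx cN]].
have h1 := Phi_local bF FL K0 (ltW e0) tK cc c01 cx cN.
have aL : l2bd L (a^~ x) by move=> n; rewrite ss_conj; exact: phiL.2.
have cx0 : c x != 0 by rewrite cx oner_eq0.
have h2 := pairing_tail (tK.2 x) aL (ltW e0) L0 (cN x cx0) (fun n => ss_le_l2bd N n aL).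
have conjsum : (\sum_(i < N) tau i x * a i x)^* = \sum_(i < N) phi i x * (tau i x)^*.
  rewrite rmorph_sum; apply: eq_bigr => i _.
  by rewrite rmorphM /a /= conjCK mulrC.
rewrite -nc_conj rmorphB /= conjsum in h2.
move: Ux h1 h2; rewrite /= /h FE tE /functional.
set P := \sum_(_ < _) _; set u := F _ _; set v := (pairing _ _)^* => h3 h1 h2.
have := ncD (u - P) (P - v); rewrite addrA subrK (ncB P).
move: h1 h2 h3 eL; rewrite (mulrC e); lra.
Qed.

End Reflexivity.

Theorem theorem4p1 (R : realType) (X : topologicalType) :
  hausdorff_space X -> compact [set: X] ->
  ~ (exists F : set X, closed F /\ homeomorphic_to_subset betaN F) ->
  l2_Cstar_reflexive R X.
Proof.
move=> hX cX nb F bF; have la := phi_l2 hX cX bF nb.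
exists (fun i y => (F (functional (delta i)) y)^*); split=> // t dt.
exact: (bidual_canon hX cX bF dt la).
Qed.
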